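(* Let $G$ be a $(2p+1)$-dimensional filiform Lie group and $\mathfrak{g}$ its Lie algebra. Suppose that the law $\mu$ of $\mathfrak{g}$ is written in an adapted basis $(X_{0},X_{1},\ldots,X_{2p})$ by the formula $$\mu=\mu_{0}+\sum_{(k,r)\in\Delta}a_{k,r}\Psi_{k,r}.$$ Then $G$ admits a left invariant contact form if and only if $$A_{j}:=\sum_{s=0}^{j-1}(-1)^{s}\,a_{p-j+s,\;2p-2(j-s-1)}\binom{2j-s-2}{s}\neq 0,\qquad j=1,2,\ldots,p-1.$$ Moreover, if this property holds, then the linear form $\alpha=b_{0}\alpha_{0}+b_{1}\alpha_{1}+\cdots+b_{2p}\alpha_{2p}$ (where $(\alpha_{0},\ldots,\alpha_{2p})$ is the basis of $\mathfrak{g}^*$ dual to $(X_{0},\ldots,X_{2p})$ and $b_i\in\mathbb{R}$) is a contact form on $\mathfrak{g}$ if and only if $b_{2p}\neq 0$.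
   Context: Lie groups are real and connected. A Lie algebra $\mathfrak{g}$ of dimension $m\ge 3$ is filiform if $\dim C^{k}\mathfrak{g}=m-k-1$ for $k=1,\ldots,m-1$, where $C^{0}\mathfrak{g}=\mathfrak{g}$ and $C^{i}\mathfrak{g}=[\mathfrak{g},C^{i-1}\mathfrak{g}]$. A Lie group is filiform if its Lie algebra is. Put $n=2p$. $\mu_{0}$ denotes the law of the Lie algebra $L_{n}$ with basis $X_{0},\ldots,X_{n}$, whose only nonzero brackets (up to antisymmetry) are $\mu_{0}(X_{0},X_{i})=X_{i+1}$, $i=1,\ldots,n-1$. $\Delta$ is the set of pairs of integers $(k,r)$ with $1\le k\le n-1$, $2k+1<r\le n$, $r\ge 4$. For $(k,r)\in\Delta$, $\Psi_{k,r}$ is the skew-symmetric bilinear map defined by $$\Psi_{k,r}(X_{i},X_{j})=-\Psi_{k,r}(X_{j},X_{i})=(-1)^{k-i}\binom{j-k-1}{k-i}X_{i+j+r-2k-1}$$ if $1\le i\le k<j\le n$ and $i+j+r-2k-1\le n$, and $\Psi_{k,r}(X_{i},X_{j})=0$ for all other pairs $i<j$ (in particular whenever $i=0$). Here $\binom{q}{s}=0$ if $q<s$ (or $q<0$). It is a 2-cocycle of $L_{n}$ with values in the adjoint module. A basis $(X_{0},\ldots,X_{n})$ of an $(n+1)$-dimensional filiform Lie algebra is adapted if its bracket has the form $[X_{i},X_{j}]=\mu_{0}(X_{i},X_{j})+\Psi(X_{i},X_{j})$, $0\le i,j\le n$, with $\Psi=\sum_{(k,r)\in\Delta}a_{k,r}\Psi_{k,r}$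 for scalars $a_{k,r}$. A contact form on a $(2p+1)$-dimensional Lie algebra $\mathfrak{g}$ is $\alpha\in\mathfrak{g}^{*}$ with $\alpha\wedge(d\alpha)^{p}\ne 0$, where $d\alpha(x,y)=-\alpha([x,y])$; a left invariant contact form on $G$ is a left invariant $1$-form $\alpha^{+}$ with $\alpha^{+}\wedge(d\alpha^{+})^{p}\neq0$. *)

(* Defs.v *)
From HB Require Import structures.
From mathcomp Require Import all_boot all_order all_algebra all_fingroup.
From mathcomp Require Import all_classical all_reals all_analysis.

Set Implicit Arguments.
Unset Strict Implicit.
Unset Printing Implicit Defensive.

Import Order.TTheory GRing.Theory Num.Theory.
Import numFieldNormedType.Exports.
Local Open Scope classical_set_scope.
Local Open Scope ring_scope.

(** * Exterior forms *)

Section ExteriorForms.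
Variables (R : fieldType) (V : lmodType R).

(* The forms used below are multilinear and alternating by construction. *)
Definition eform (k : nat) := ('I_k -> V) -> R.

Definition form1 (a : V -> R) : eform 1 := fun v => a (v ord0).

Definition wedge k l (w : eform k) (h : eform l) : eform (k + l) :=
  fun v => (k`! * l`!)%:R^-1 *
    \sum_(s : 'S_(k + l)) (-1) ^+ s *
      w (fun i => v (s (lshift l i))) * h (fun i => v (s (rshift k i))).

Fixpoint wedge_pow (w : eform 2) (p : nat) : eform (p * 2) :=
  match p with
  | 0%N => fun=> 1
  | q.+1 => wedge w (@wedge_pow w q)
  end.

Definition contact_volume p (a : V -> R) (da : eform 2) : eform (1 + p * 2) :=
  wedge (form1 a) (@wedge_pow da p).

End ExteriorForms.
Arguments wedge_pow {R V} w p _.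
Arguments contact_volume {R V} p a da _.

(** * Lie algebras *)

Record lieAlgebra (R : fieldType) := LieAlgebra {
  la_space :> vectType R;
  bracket : la_space -> la_space -> la_space;
  bracket_linearr : forall x, linear (bracket x);
  bracket_linearl : forall y, linear (bracket^~ y);
  bracketxx : forall x, bracket x x = 0;
  bracket_jacobi : forall x y z,
    bracket x (bracket y z) + bracket y (bracket z x) + bracket z (bracket x y)
    = 0
}.

Section LieAlgebraNotions.
Variables (R : fieldType) (g : lieAlgebra R).

(* By bilinearity, brackets of basis vectors span [g, C^{i-1} g]. *)
Fixpoint lower_central (i : nat) : {vspace g} :=
  match i with
  | 0%N => fullv
  | i'.+1 => <<[seq bracket x y | x <- vbasis (fullv : {vspace g}),
                                  y <- vbasis (lower_central i')]>>%VS
  end.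

Definition filiform : Prop :=
  let m := \dim (fullv : {vspace g}) in
  (3 <= m)%N /\
  forall k, (1 <= k <= m - 1)%N -> \dim (lower_central k) = (m - k - 1)%N.

Definition ce_diff (alpha : g -> R) : eform g 2 :=
  fun v => - alpha (bracket (v ord0) (v ord_max)).

Definition contact_form (p : nat) (alpha : g -> R) : Prop :=
  scalar alpha /\ exists v, contact_volume p alpha (ce_diff alpha) v != 0.

End LieAlgebraNotions.

(** * The model filiform law and its deformations *)

Section Laws.
Variables (R : fieldType) (g : lieAlgebra R) (n : nat).
(* X`_l is the l-th basis vector for l <= n, and 0 for l > n. *)
Variable X : n.+1.-tuple g.

Definition mu0 (i j : nat) : g :=
  if (i == 0%N) && (1 <= j <= n - 1)%N then X`_j.+1
  else if (j == 0%N) && (1 <= i <= n - 1)%N then - X`_i.+1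
  else 0.

Definition Delta (k r : nat) : bool :=
  [&& (1 <= k <= n - 1)%N, (2 * k + 1 < r <= n)%N & (4 <= r)%N].

(* Psi_{k,r}(X_i, X_j) for i < j; as 2k+1 < r, the truncated subtractions are
   the integer ones wherever the first branch is taken. *)
Definition Psi_lt (k r i j : nat) : g :=
  if [&& (1 <= i <= k)%N, (k < j <= n)%N & (i + j + r - (2 * k + 1) <= n)%N]
  then ((-1) ^+ (k - i) * 'C(j - k - 1, k - i)%:R)
         *: X`_(i + j + r - (2 * k + 1))
  else 0.

Definition Psi (k r i j : nat) : g :=
  if (i < j)%N then Psi_lt k r i j
  else if (j < i)%N then - Psi_lt k r j i
  else 0.

Definition adapted_basis (a : nat -> nat -> R) : Prop :=
  basis_of fullv X /\
  forall i j : 'I_n.+1,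
    bracket X`_i X`_j =
      mu0 i j + \sum_(k < n.+1) \sum_(r < n.+1 | Delta k r)
                  a k r *: Psi k r i j.

End Laws.

(** * Smooth maps *)

Section Smooth.
Variables (R : realType) (V W : normedModType R).

(* For V finite-dimensional: f is C^k at the points of the open set U. *)
Fixpoint Ck (k : nat) (U : set V) (f : V -> W) : Prop :=
  match k with
  | 0%N => forall x, U x -> {for x, continuous f}
  | k'.+1 => (forall x, U x -> differentiable f x) /\
             forall v, Ck k' U (fun x => 'D_v f x)
  end.

Definition smooth (U : set V) (f : V -> W) : Prop := forall k, Ck k U f.

End Smooth.

(** * Lie groups *)

HB.mixin Record isTopGroup G of monoid.Group G & Topological G := {
  mulg_cts : continuous (fun xy : G * G => (xy.1 * xy.2)%g);
  invg_cts : continuous (fun x : G => x^-1%g)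
}.

#[short(type="topGroupType")]
HB.structure Definition TopGroup :=
  { G of monoid.Group G & Topological G & isTopGroup G }.

(* Connected real Lie groups of dimension m, given by a smooth atlas. The total
   functions chart i and param i are only meaningful on dom i and on its image
   chart i @` dom i respectively. *)
Record lieGroup (R : realType) (m : nat) := LieGroup {
  lg_group :> topGroupType;
  lg_hausdorff : hausdorff_space lg_group;
  lg_second_countable : @second_countable lg_group;
  lg_connected : connected [set: lg_group];
  atlas : Type;
  dom : atlas -> set lg_group;
  chart : atlas -> lg_group -> 'rV[R]_m;
  param : atlas -> 'rV[R]_m -> lg_group;
  dom_cover : forall x, exists i, dom i x;
  dom_open : forall i, open (dom i);
  img_open : forall i, open (chart i @` dom i);
  chartK : forall i x, dom i x -> param i (chart i x) = x;
  chart_cts : forall i x, dom i x -> {for x, continuous (chart i)};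
  param_cts : forall i z, (chart i @` dom i) z -> {for z, continuous (param i)};
  transition_smooth : forall i j,
    smooth [set z | (chart i @` dom i) z /\ dom j (param i z)]
           (fun z => chart j (param i z));
  mulg_smooth : forall i j k,
    smooth [set zw : 'rV[R]_m * 'rV[R]_m |
              [/\ (chart i @` dom i) zw.1, (chart j @` dom j) zw.2 &
                  dom k (param i zw.1 * param j zw.2)%g]]
           (fun zw => chart k (param i zw.1 * param j zw.2)%g);
  invg_smooth : forall i j,
    smooth [set z | (chart i @` dom i) z /\ dom j (param i z)^-1%g]
           (fun z => chart j (param i z)^-1%g)
}.

(** * Left invariant vector fields and forms *)

(* A vector field or a 1-form on G is represented by the family of its local
   expressions in the charts; only the values of the i-th one on img i count.
   Compatibility with changes of charts is the case h = 1 of left invariance. *)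
Section LeftInvariant.
Variables (R : realType) (m : nat) (G : lieGroup R m).

Definition img (i : atlas G) : set 'rV[R]_m := chart i @` dom i.

Definition local_field := atlas G -> 'rV[R]_m -> 'rV[R]_m.
Definition local_form := atlas G -> 'rV[R]_m -> ('rV[R]_m -> R).

(* Left translation by h, read in the charts i and j. *)
Definition ltrans (h : G) (i j : atlas G) (z : 'rV[R]_m) : 'rV[R]_m :=
  chart j (h * param i z)%g.

Definition left_invariant_field (X : local_field) : Prop :=
  (forall i, smooth (img i) (X i)) /\
  forall (h : G) i j z, img i z -> dom j (h * param i z)%g ->
    X j (ltrans h i j z) = 'd (ltrans h i j) z (X i z).

Definition left_invariant_form (w : local_form) : Prop :=
  [/\ forall i z, img i z -> scalar (w i z),
      forall i v, smooth (img i) (fun z => w i z v) &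
      forall (h : G) i j z, img i z -> dom j (h * param i z)%g ->
        forall v, w j (ltrans h i j z) ('d (ltrans h i j) z v) = w i z v].

Definition field_bracket (X Y : local_field) : local_field :=
  fun i z => 'D_(X i z) (Y i) z - 'D_(Y i z) (X i) z.

Definition ext_diff (w : local_form) (i : atlas G) (z : 'rV[R]_m)
    : eform 'rV[R]_m 2 :=
  fun v => 'D_(v ord0) (fun z' => w i z' (v ord_max)) z
         - 'D_(v ord_max) (fun z' => w i z' (v ord0)) z.

(* alpha /\ (d alpha)^p vanishes nowhere; for left invariant forms this is the
   same as not being identically zero. *)
Definition left_invariant_contact_form (p : nat) (w : local_form) : Prop :=
  left_invariant_form w /\
  forall i z, img i z ->
    exists v, contact_volume p (w i z) (ext_diff w i z) v != 0.

(* iota identifies g with the Lie algebra of left invariant vector fields. *)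
Record is_lie_algebra_of (g : lieAlgebra R) (iota : g -> local_field) : Prop :=
  IsLieAlgebraOf {
    iota_left_invariant : forall x, left_invariant_field (iota x);
    iota_linear : forall (c : R) x y i z, img i z ->
      iota (c *: x + y) i z = c *: iota x i z + iota y i z;
    iota_injective : forall x,
      (forall i z, img i z -> iota x i z = 0) -> x = 0;
    iota_surjective : forall X, left_invariant_field X ->
      exists x, forall i z, img i z -> iota x i z = X i z;
    iota_bracket : forall x y i z, img i z ->
      iota (bracket x y) i z = field_bracket (iota x) (iota y) i z
  }.

End LeftInvariant.

(* For 1 <= j <= p - 1 and s < j no subtraction truncates, and all the index
   pairs of a lie in Delta (with n = 2p). *)
Definition A_coef (R : fieldType) (p : nat) (a : nat -> nat -> R) (j : nat) : R :=
  \sum_(s < j)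
    (-1) ^+ s * a (p - j + s)%N (2 * p - 2 * (j - s - 1))%N
    * 'C(2 * j - s - 2, s)%:R.

(* Main.v *)
(* In the adapted basis [X_i, X_j] lies in the span of the X_l with l > i + j, so
   X_(2p) is central and the matrix of d alpha on X_0, ..., X_(2p - 1) is
   antitriangular. Its antidiagonal entries are, up to sign, b_(2p) for i = 0 and
   b_(2p) A_(p - i) for 0 < i < p. A top degree form alpha /\ (d alpha)^p is
   nonzero exactly when no nonzero vector is killed by both alpha and d alpha:
   such a vector annihilates the whole form, and conversely a symplectic frame,
   completed by X_(2p), evaluates to a nonzero number. Hence alpha is contact if
   and only if b_(2p) and all the A_j are nonzero. On the group, evaluation at a
   point identifies g with the tangent space, and Cartan's formula turns the
   exterior derivative of a left invariant form into d alpha; the extension of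
   alpha to a left invariant form is smooth by Cramer's rule. *)
Require Import Defs.
From mathcomp Require Import all_boot all_order all_algebra all_fingroup.
From mathcomp Require Import all_classical all_reals all_analysis.
From mathcomp Require Import ring lra zify.

Set Implicit Arguments.
Unset Strict Implicit.
Unset Printing Implicit Defensive.

Import Order.TTheory GRing.Theory Num.Theory.
Import numFieldNormedType.Exports.
Local Open Scope ring_scope.

(** * Permutations and index shifts *)

Lemma lift_perm_surj n (i : 'I_n.+1) (s : 'S_n.+1) :
  exists t, s = lift_perm i (s i) t.
Proof.
(* The default [k] is never reached, since [s (lift i k)] differs from [s i]. *)
pose f (k : 'I_n) := odflt k (unlift (s i) (s (lift i k))).
have fK k : lift (s i) (f k) = s (lift i k).
  rewrite /f; have := neq_lift i k.
  by rewrite -(inj_eq (@perm_inj _ s)) => /unlift_some[] ? ? ->.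
have f_inj : injective f.
  by move=> k l /(congr1 (lift (s i))); rewrite !fK => /perm_inj/lift_inj.
exists (perm f_inj); apply/permP => k.
case: (unliftP i k) => [k'|] ->; last by rewrite lift_perm_id.
by rewrite lift_perm_lift permE fK.
Qed.

Lemma sumr_gt0 (R : realFieldType) (I : finType) (i : I) (F : I -> R) :
  (forall j, 0 <= F j) -> 0 < F i -> 0 < \sum_j F j.
Proof.
move=> F0 Fi; rewrite (bigD1 i) //=; apply: ltr_pwDl => //.
by apply: sumr_ge0.
Qed.

(** As [bump i j] differs from [i], equal halves make them the two members 2q and 2q+1 of one
    hyperbolic pair, in either order. *)
Lemma half_bump (i j : nat) : i./2 = (bump i j)./2 ->
  [/\ i = j, ~~ odd i & bump i j = j.+1] \/
  [/\ i = j.+1, odd i & bump i j = j].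
Proof.
by rewrite /bump; case: leqP => /= h ij; [left|right]; split; lia.
Qed.

(** Skipping both members of a pair moves the later indices by two, which keeps parity and pairing;
    the induction in [wedge_pow_symplectic] rests on this. *)
Lemma bump_bump (i j a : nat) : i./2 = (bump i j)./2 ->
  bump i (bump j a) = if (a < i./2.*2)%N then a else a.+2.
Proof.
move=> /half_bump[[ij jo _]|[ij jo _]];
  rewrite /bump; case: (ltnP a) => ai; case: (leqP j a) => ja /=; lia.
Qed.

(** * Antisymmetry, multilinearity and kernels of wedge products *)

Section AlternatingForms.
Variables (R : fieldType) (V : lmodType R).

Lemma scalar0 (f : V -> R) : scalar f -> f 0 = 0.
Proof.
by move=> lf; have := lf (-1) 0 0; rewrite scaler0 addr0 mulN1r addNr.
Qed.

Lemma scalar_scale (f : V -> R) c x : scalar f -> f (c *: x) = c * f x.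
Proof. by move=> lf; have := lf c x 0; rewrite scalar0 // !addr0. Qed.

Lemma linear_lin_comb (W : lmodType R) (f : V -> W) n (c : 'I_n -> R)
    (y : 'I_n -> V) :
  linear f -> f (\sum_j c j *: y j) = \sum_j c j *: f (y j).
Proof.
move=> lf; elim: n c y => [|n IH] c y; last by rewrite !big_ord_recl lf IH.
by rewrite !big_ord0; have := lf (-1) 0 0; rewrite scaler0 addr0 scaleN1r addNr.
Qed.

Lemma scalar_lin_comb (f : V -> R) n (c : 'I_n -> R) (y : 'I_n -> V) :
  scalar f -> f (\sum_j c j *: y j) = \sum_j c j * f (y j).
Proof. exact: (@linear_lin_comb R^o). Qed.

Definition antisymmetric k (w : eform V k) : Prop :=
  forall (s : 'S_k) v, w (fun i => v (s i)) = (-1) ^+ s * w v.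

Definition subst k (v : 'I_k -> V) (i : 'I_k) (x : V) : 'I_k -> V :=
  fun j => if j == i then x else v j.

Definition multilinear k (w : eform V k) : Prop :=
  forall v i, scalar (fun x => w (subst v i x)).

(** For an antisymmetric form this is the vanishing of the contraction by [x]; admitting every
    position lets it pass to wedge products without signs. *)
Definition annihilates (x : V) k (w : eform V k) : Prop :=
  forall v i, v i = x -> w v = 0.

Lemma wedge_antisymmetric k l (w : eform V k) (h : eform V l) :
  antisymmetric (wedge w h).
Proof.
move=> s v; rewrite /wedge mulrCA; congr (_ * _).
(* Substituting [t * s^-1] absorbs [s] into the summation index and leaves its sign. *)
rewrite (reindex_inj (mulIg s^-1%g)) /= mulr_sumr; apply: eq_bigr => t _.
rewrite odd_permM odd_permV signr_addb [in RHS]mulrA [in RHS]mulrA.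
congr (_ * _ * _); [exact: mulrC|congr w|congr h]; apply/funext => i;
  by rewrite -permM mulgKV.
Qed.

Lemma wedge_multilinear k l (w : eform V k) (h : eform V l) :
  multilinear w -> multilinear h -> multilinear (wedge w h).
Proof.
move=> mw mh v i c x y; rewrite /wedge mulrCA -mulrDr; congr (_ * _).
rewrite mulr_sumr -big_split; apply: eq_bigr => s _ /=.
(* Exactly one factor reads the argument [v i]; the side of the split containing [s^-1 i] tells
   which. *)
have wE z : w (fun a => subst v i z (s (lshift l a))) =
    if fintype.split (s^-1%g i) is inl a
    then w (subst (fun a => v (s (lshift l a))) a z)
    else w (fun a => v (s (lshift l a))).
  case: fintype.splitP => [a|a] Ea; congr w; apply/funext => b; rewrite /subst.
  - have -> : (s (lshift l b) == i) = (b == a) => //.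
    rewrite -(inj_eq (@perm_inj _ s^-1%g)) permK -val_eqE /= Ea.
    by rewrite val_eqE.
  - rewrite ifN // -(inj_eq (@perm_inj _ s^-1%g)) permK -val_eqE /= Ea.
    by rewrite neq_ltn ltn_addr.
have hE z : h (fun a => subst v i z (s (rshift k a))) =
    if fintype.split (s^-1%g i) is inr a
    then h (subst (fun a => v (s (rshift k a))) a z)
    else h (fun a => v (s (rshift k a))).
  case: fintype.splitP => [a|a] Ea; congr h; apply/funext => b; rewrite /subst.
  - rewrite ifN // -(inj_eq (@perm_inj _ s^-1%g)) permK -val_eqE /= Ea.
    by rewrite neq_ltn ltn_addr ?orbT.
  - have -> : (s (rshift k b) == i) = (b == a) => //.
    rewrite -(inj_eq (@perm_inj _ s^-1%g)) permK -val_eqE /= Ea.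
    by rewrite eqn_add2l val_eqE.
rewrite (wE x) (wE y) (wE (c *: x + y)) (hE x) (hE y) (hE (c *: x + y)).
case: (fintype.split _) => a.
- rewrite (mw (fun b => v (s (lshift l b))) a c x y).
  by rewrite mulrDr mulrDl mulrCA !mulrA.
- rewrite (mh (fun b => v (s (rshift k b))) a c x y).
  by rewrite mulrDr mulrCA !mulrA.
Qed.

Lemma wedge_annihilates x k l (w : eform V k) (h : eform V l) :
  annihilates x w -> annihilates x h -> annihilates x (wedge w h).
Proof.
move=> xw xh v i vi; rewrite /wedge big1 ?mulr0 // => s _.
have [j ij] : exists j, s j = i by exists (s^-1%g i); rewrite permKV.
case: (split_ordP j) => a ja; rewrite ja in ij.
- by rewrite (xw _ a) ?mulr0 ?mul0r //= ij.
- by rewrite (xh _ a) ?mulr0 //= ij.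
Qed.

Lemma subst_id k (v : 'I_k -> V) i : subst v i (v i) = v.
Proof. by apply/funext => j; rewrite /subst; case: eqP => [->|]. Qed.

End AlternatingForms.

Section FormsOverRealFields.
Variables (R : realFieldType) (V : lmodType R).

Lemma antisymmetric_repeat k (w : eform V k) v i j :
  antisymmetric w -> i != j -> v i = v j -> w v = 0.
Proof.
move=> aw ij vij; have := aw (tperm i j) v.
have -> : (fun l => v (tperm i j l)) = v.
  by apply/funext => l; case: tpermP => // ->.
by rewrite odd_tperm ij mulN1r; lra.
Qed.

(** Putting [x] in place [i] gives zero. When [x] is expanded, every term with [j != i] repeats an
    argument, so only [c i * w v] remains. *)
Lemma annihilated_lin_comb k (w : eform V k) v x (c : 'I_k -> R) i :
  antisymmetric w -> multilinear w -> annihilates x w ->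
  \sum_j c j *: v j = x -> c i != 0 -> w v = 0.
Proof.
move=> aw mw xw cx ci0.
have: w (subst v i x) = 0 by apply: (xw _ i); rewrite /subst eqxx.
rewrite -cx (scalar_lin_comb _ _ (mw v i)) (bigD1 i) //= big1 => [|j ji].
  by rewrite subst_id addr0 => /eqP; rewrite mulf_eq0 (negPf ci0) => /eqP.
rewrite (@antisymmetric_repeat _ _ _ j i) ?mulr0 //.
by rewrite /subst eqxx (negPf ji).
Qed.

Lemma annihilates0 k (w : eform V k) : multilinear w -> annihilates 0 w.
Proof.
move=> mw v i vi; have := scalar0 (mw v i).
by rewrite -[X in subst v i X]vi subst_id.
Qed.

End FormsOverRealFields.

(** * Powers of an alternating bilinear form and symplectic frames *)

Section BilinearForms.
Variables (R : realFieldType) (V : lmodType R) (B : V -> V -> R).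
Hypothesis B_linearr : forall x, scalar (B x).
Hypothesis B_alt : forall x, B x x = 0.
Hypothesis B_linearl : forall y, scalar (B^~ y).

Let form2 : eform V 2 := fun v => B (v ord0) (v ord_max).

Lemma alternating_antisymmetric x y : B x y = - B y x.
Proof.
have Dr a b c : B a (b + c) = B a b + B a c.
  by have := B_linearr a 1 b c; rewrite scale1r mul1r.
have Dl a b c : B (b + c) a = B b a + B c a.
  by have := B_linearl a 1 b c; rewrite scale1r mul1r.
have := B_alt (x + y); rewrite Dr !Dl !B_alt; lra.
Qed.

Lemma form2_multilinear : multilinear form2.
Proof.
move=> v i c x y; rewrite /form2 /subst.
have /orP[/eqP<-|/eqP<-] : (ord0 == i) || (ord_max == i).
  by case: i => [[|[|]]].
- by rewrite eqxx /= B_linearl.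
- by rewrite eqxx /= B_linearr.
Qed.

Lemma form1_multilinear (a : V -> R) : scalar a -> multilinear (form1 a).
Proof. by move=> la v i c x y; rewrite /form1 /subst !ord1 eqxx la. Qed.

Lemma wedge_pow_antisymmetric p : antisymmetric (wedge_pow form2 p).
Proof.
case: p => [|p]; last exact: wedge_antisymmetric.
by move=> s v; rewrite /= (permS0 s) odd_perm1 mulr1.
Qed.

Lemma wedge_pow_multilinear p : multilinear (wedge_pow form2 p).
Proof.
elim: p => [|p IH]; first by move=> v [].
by apply: wedge_multilinear => //; exact: form2_multilinear.
Qed.

Lemma wedge_pow_annihilates x p :
  (forall y, B x y = 0) -> annihilates x (wedge_pow form2 p).
Proof.
move=> xB; elim: p => [|p IH]; first by move=> v [].
apply: wedge_annihilates => // v i vi; rewrite /form2.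
have /orP[/eqP i0|/eqP i1] : (ord0 == i) || (ord_max == i).
  by case: (i) => [[|[|]]].
- by rewrite i0 vi xB.
- by rewrite i1 vi alternating_antisymmetric xB oppr0.
Qed.

Lemma contact_volume_antisymmetric p a :
  antisymmetric (contact_volume p a form2).
Proof. exact: wedge_antisymmetric. Qed.

Lemma contact_volume_multilinear p a :
  scalar a -> multilinear (contact_volume p a form2).
Proof.
move=> la; apply: wedge_multilinear; last exact: wedge_pow_multilinear.
exact: form1_multilinear.
Qed.

Lemma contact_volume_annihilates x p (a : V -> R) :
  a x = 0 -> (forall y, B x y = 0) ->
  annihilates x (contact_volume p a form2).
Proof.
move=> ax xB; apply: wedge_annihilates; last exact: wedge_pow_annihilates.
by move=> v i; rewrite /form1 (ord1 i) => ->.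
Qed.

(* The Gram matrix of a sequence of mutually orthogonal hyperbolic pairs. *)
Definition symplectic_entry (i j : nat) : R :=
  if i./2 == j./2 then (odd j)%:R - (odd i)%:R else 0.

Lemma symplectic_entry_bump i j a b : i./2 = (bump i j)./2 ->
  symplectic_entry (bump i (bump j a)) (bump i (bump j b)) =
  symplectic_entry a b.
Proof.
move=> ij; rewrite !bump_bump // /symplectic_entry.
case: (ltnP a) => ai; case: (ltnP b) => bi; rewrite /= ?negbK ?eqSS //.
- by rewrite !ifN //; apply/eqP; lia.
- by rewrite !ifN //; apply/eqP; lia.
Qed.

(* Every permutation is lift_perm 0 i (lift_perm 0 j u). Its term is zero unless
   e i and e (lift i j) form a hyperbolic pair, and then all the signs cancel:
   removing that pair leaves a symplectic frame, permuted by u. *)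
Lemma wedge_pow_symplectic p (e : 'I_(p * 2) -> V) :
  (forall i j, B (e i) (e j) = symplectic_entry i j) ->
  0 < wedge_pow form2 p e.
Proof.
elim: p e => [|p IH] e eJ; first exact: ltr01.
rewrite /= /wedge pmulr_rgt0; last by rewrite invr_gt0 ltr0n muln_gt0 !fact_gt0.
pose F (s : 'S_(2 + p * 2)) := (-1) ^+ s
  * form2 (fun i => e (s (lshift (p * 2) i)))
  * wedge_pow form2 p (fun i => e (s (rshift 2 i))).
have l0 : lshift (p * 2) (ord0 : 'I_2) = ord0 :> 'I_(p * 2).+2.
  exact: val_inj.
have l1 : lshift (p * 2) (ord_max : 'I_2) = lift ord0 ord0 :> 'I_(p * 2).+2.
  exact: val_inj.
have l2 i : rshift 2 i = lift ord0 (lift ord0 i) :> 'I_(p * 2).+2.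
  exact: val_inj.
have F_ge0 s : 0 <= F s.
  rewrite /F /form2 l0 l1.
  have [t ->] := lift_perm_surj (ord0 : 'I_(p * 2).+2) s.
  have [u ->] := lift_perm_surj (ord0 : 'I_(p * 2).+1) t.
  set i := s ord0; set j := t ord0.
  rewrite !odd_lift_perm lift_perm_id lift_perm_lift lift_perm_id eJ !addFb.
  have -> : (fun a => e (lift_perm ord0 i (lift_perm ord0 j u) (rshift 2 a)))
      = (fun a => e (lift i (lift j (u a)))).
    by apply/funext => a; rewrite l2 !lift_perm_lift.
  rewrite (@wedge_pow_antisymmetric p u (fun a => e (lift i (lift j a)))).
  have sgnE (b c d : bool) (x y : R) : (-1) ^+ (b (+) (c (+) d)) * x
      * ((-1) ^+ d * y) = (-1) ^+ (b (+) c) * x * y.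
    by case: b c d => [] [] []; rewrite /= ?expr0 ?expr1; ring.
  rewrite sgnE /symplectic_entry.
  case: eqP => ij; last by rewrite mulr0 mul0r.
  apply: mulr_ge0; last first.
    by apply/ltW/IH => a b; rewrite eJ symplectic_entry_bump.
  rewrite [nat_of_ord (lift i j)]/=.
  have [[iE io ->]|[iE io ->]] := half_bump ij; move: io; rewrite iE /=;
    case: (odd j) => //= _; rewrite ?expr0 ?expr1; lra.
(* No term is negative, so one positive term suffices: the identity pairs [e 0] with [e 1], with
   value 1, and leaves a smaller symplectic frame. *)
apply: (@sumr_gt0 _ _ 1%g) => [s|]; first exact: F_ge0.
rewrite odd_perm1 expr0 mul1r {1}/form2 !perm1 eJ /symplectic_entry /=.
rewrite subr0 mul1r.
have -> : (fun a => e ((1%g : 'S_(2 + p * 2)) (rshift 2 a)))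
   = (fun a => e (rshift 2 a)) by apply/funext => a; rewrite perm1.
by apply: IH => a b; rewrite eJ /symplectic_entry /= !negbK.
Qed.

(** A permutation that moves 0 puts [z] into the power of [B], which [z] annihilates. Each
    permutation fixing 0 contributes [a z] times the positive value of that power on [e]. *)
Lemma contact_volume_symplectic p (a : V -> R) z (e : 'I_(p * 2) -> V) :
  (forall y, B z y = 0) -> a z != 0 ->
  (forall i j, B (e i) (e j) = symplectic_entry i j) ->
  contact_volume p a form2 (fun i => oapp e z (unlift ord0 i)) != 0.
Proof.
move=> zB az eJ; set v := fun i => _.
(* The sign of [a z] is unknown; the extra factor [a z] turns it into a square. *)
suff /lt0r_neq0 : 0 < a z * contact_volume p a form2 v.
  by rewrite mulf_eq0 negb_or => /andP[].
rewrite /contact_volume /wedge mulrCA pmulr_rgt0; last first.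
  by rewrite invr_gt0 ltr0n muln_gt0 !fact_gt0.
have l0 : lshift (p * 2) (ord0 : 'I_1) = ord0 :> 'I_(p * 2).+1.
  exact: val_inj.
have l1 i : rshift 1 i = lift ord0 i :> 'I_(p * 2).+1 by exact: val_inj.
have az2 : 0 < a z * a z by rewrite -expr2 exprn_even_gt0.
rewrite mulr_sumr; apply: (@sumr_gt0 _ _ 1%g) => [s|]; last first.
  rewrite odd_perm1 expr0 mul1r mulrA {1}/form1 perm1 l0 {1}/v unlift_none /=.
  rewrite pmulr_rgt0 //.
  have -> : (fun i => v ((1%g : 'S_(1 + p * 2)) (rshift 1 i))) = e.
    by apply/funext => i; rewrite perm1 l1 /v liftK.
  exact: wedge_pow_symplectic.
have [t ->] := lift_perm_surj (ord0 : 'I_(p * 2).+1) s.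
rewrite /form1 l0 lift_perm_id.
case: (unliftP ord0 (s ord0)) => [k|] s0.
  have [i Ei _] : {i | ord0 = lift (s ord0) i & unlift (s ord0) ord0 = Some i}.
    by apply: unlift_some; rewrite s0 eq_sym neq_lift.
  rewrite (@wedge_pow_annihilates z p zB _ (t^-1%g i)) ?mulr0 //.
  by rewrite l1 lift_perm_lift permKV -Ei /v unlift_none.
rewrite s0 odd_lift_perm !addFb {1}/v unlift_none /=.
have -> : (fun i => v (lift_perm ord0 ord0 t (rshift 1 i))) =
    (fun i => e (t i)).
  by apply/funext => i; rewrite l1 lift_perm_lift /v liftK.
rewrite wedge_pow_antisymmetric.
have := wedge_pow_symplectic eJ; set W := wedge_pow _ _ _ => W0.
rewrite (_ : _ * _ = a z * a z * W); first exact/ltW/mulr_gt0.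
by case: (odd_perm t); rewrite ?expr0 ?expr1; ring.
Qed.

(* Gram-Schmidt: v 0 pairs with v (2p - 1), to which only v 0 is not orthogonal,
   so the other vectors become orthogonal to both after subtracting multiples of
   v (2p - 1); their Gram matrix is unchanged. The first clause says that e lies
   in the span of v. *)
Lemma antitriangular_symplectic p (v : nat -> V) :
  (forall i j, (i < p.*2)%N -> (j < p.*2)%N -> (p.*2 <= i + j)%N ->
     B (v i) (v j) = 0) ->
  (forall i j, (i + j).+1 = p.*2 -> B (v i) (v j) != 0) ->
  exists e : nat -> V,
    (forall y, (forall i, (i < p.*2)%N -> B (v i) y = 0) ->
       forall i, (i < p.*2)%N -> B (e i) y = 0) /\
    (forall i j, (i < p.*2)%N -> (j < p.*2)%N ->
       B (e i) (e j) = symplectic_entry i j).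
Proof.
elim: p v => [|p IH] v v0 vn0; first by exists v.
have Bl c x y z : B (x - c *: y) z = B x z - c * B y z.
  by rewrite addrC -scaleNr B_linearl mulNr addrC.
have Br c x y z : B z (x - c *: y) = B z x - c * B z y.
  by rewrite addrC -scaleNr B_linearr mulNr addrC.
have Bs c x z : B z (c *: x) = c * B z x by exact: scalar_scale.
set L := p.*2.+1; set d := B (v L) (v 0%N).
have d0 : d != 0 by apply: vn0; rewrite addn0.
have vLL j : (0 < j <= L)%N -> B (v L) (v j) = 0.
  by rewrite /L => ?; apply: v0; lia.
pose u i := v i.+1 - (B (v i.+1) (v 0%N) / d) *: v L.
have u0 i : B (u i) (v 0%N) = 0 by rewrite Bl mulfVK // subrr.
have uL i : (i < p.*2)%N -> B (u i) (v L) = 0.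
  move=> ip; rewrite Bl B_alt mulr0 subr0 alternating_antisymmetric.
  rewrite vLL ?oppr0 //.
  by rewrite /L; lia.
have uE i j : (i < p.*2)%N -> (j < p.*2)%N ->
    B (u i) (u j) = B (v i.+1) (v j.+1).
  move=> ip jp; rewrite Br uL // mulr0 subr0 Bl vLL ?mulr0 ?subr0 //.
  by rewrite /L; lia.
have [||e [eu eJ]] := IH u.
- by move=> i j ip jp ij; rewrite uE //; apply: v0; lia.
- by move=> i j ij; rewrite uE; [apply: vn0; lia|lia|lia].
(* As [d] is [B (v L) (v 0)], the factor [- d^-1] makes the first pair have value 1. *)
exists (fun i =>
  match i with 0 => v 0%N | 1 => - d^-1 *: v L | k.+2 => e k end).
split=> [y vy [|[|i]] ip|].
- exact: vy.
- rewrite alternating_antisymmetric Bs alternating_antisymmetric vy //.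
  by rewrite oppr0 mulr0 oppr0.
- apply: eu; last by lia.
  by move=> j jp; rewrite Bl !vy ?mulr0 ?subrr ?subr0 // /L; lia.
have e0 i : (i < p.*2)%N -> B (e i) (v 0%N) = 0 by move=> ?; apply: eu.
have eL i : (i < p.*2)%N -> B (e i) (v L) = 0 by move=> ?; apply: eu.
have J01 : B (v 0%N) (- d^-1 *: v L) = 1.
  by rewrite Bs alternating_antisymmetric -/d; field.
move=> [|[|i]] [|[|j]] ip jp; rewrite ?B_alt /symplectic_entry /= ?negbK ?eqSS.
- by rewrite subrr.
- by rewrite J01 subr0.
- by rewrite alternating_antisymmetric e0 ?oppr0.
- by rewrite alternating_antisymmetric J01 sub0r.
- by rewrite subrr.
- by rewrite alternating_antisymmetric Bs eL ?mulr0 ?oppr0.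
- by rewrite e0.
- by rewrite Bs eL ?mulr0.
- by rewrite eJ.
Qed.

End BilinearForms.

(** * Nondegeneracy of a nonzero contact volume *)

Section Nondegeneracy.
Variables (R : realFieldType) (V : vectType R).
Variables (B : V -> V -> R) (a : V -> R).
Hypothesis B_linearr : forall x, scalar (B x).
Hypothesis B_alt : forall x, B x x = 0.
Hypothesis B_linearl : forall y, scalar (B^~ y).
Hypothesis a_scalar : scalar a.

(** Both 0 and [x] annihilate the volume, so a combination of the [v i] equal to either has zero
    coefficients. For 0 this makes the [v i] free, hence a basis by dimension; for [x] it then gives
    [x = 0]. *)
Lemma contact_volume_nondegenerate p v x :
  \dim (fullv : {vspace V}) = (p * 2).+1 ->
  contact_volume p a (fun u => B (u ord0) (u ord_max)) v != 0 ->
  a x = 0 -> (forall y, B x y = 0) -> x = 0.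
Proof.
move=> dimV vol0 ax xB.
have asym := contact_volume_antisymmetric B (p := p) a.
have mul := contact_volume_multilinear B_linearr B_linearl (p := p) a_scalar.
pose X := [tuple v i | i < (p * 2).+1].
have XE (i : 'I_(p * 2).+1) : X`_i = v i by rewrite -tnth_nth tnth_mktuple.
have no_comb c y : annihilates y (contact_volume p a
      (fun u => B (u ord0) (u ord_max))) ->
    \sum_(i < (p * 2).+1) c i *: X`_i = y -> forall i, c i = 0.
  move=> yann cy i; apply/eqP; apply: contraNT vol0 => ci.
  apply/eqP/(annihilated_lin_comb asym mul yann _ ci).
  by rewrite -cy; apply: eq_bigr => j _; rewrite XE.
have Xfree : free X.
  by apply/freeP => c c0; apply: (no_comb c 0) => //; exact: annihilates0.
have Xbasis : basis_of fullv X.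
  by rewrite basisEfree Xfree subvf size_tuple dimV /=.
have xE := coord_basis Xbasis (memvf x).
have xann :=
  contact_volume_annihilates B_linearr B_alt B_linearl (p := p) ax xB.
rewrite xE big1 // => i _.
by rewrite (no_comb _ _ xann (esym xE)) scale0r.
Qed.

End Nondegeneracy.

(** * Naturality of the contact volume *)

Section Pullback.
Variables (R : fieldType) (V W : lmodType R) (f : V -> W).

Lemma wedge_pullback k l (w : eform W k) (h : eform W l) (w' : eform V k)
    (h' : eform V l) v :
  (forall v, w (fun i => f (v i)) = w' v) ->
  (forall v, h (fun i => f (v i)) = h' v) ->
  wedge w h (fun i => f (v i)) = wedge w' h' v.
Proof.
move=> ww hh; rewrite /wedge; congr (_ * _); apply: eq_bigr => s _.
by rewrite -ww -hh.
Qed.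

Lemma contact_volume_pullback p (a : W -> R) (w : eform W 2) (a' : V -> R)
    (w' : eform V 2) v :
  (forall x, a (f x) = a' x) -> (forall v, w (fun i => f (v i)) = w' v) ->
  contact_volume p a w (fun i => f (v i)) = contact_volume p a' w' v.
Proof.
move=> aa ww; apply: wedge_pullback => [u|]; first by rewrite /form1 aa.
by elim: p {v} => [|p IH] u //; exact: wedge_pullback.
Qed.

End Pullback.

(** * The contact criterion on the Lie algebra *)

Section ContactFormsOnLieAlgebra.
Variables (R : realFieldType) (p : nat) (g : lieAlgebra R).
Variables (X : (2 * p).+1.-tuple g) (a : nat -> nat -> R).
Hypothesis X_adapted : adapted_basis X a.

Lemma bracket_adapted i j : (i <= 2 * p)%N -> (j <= 2 * p)%N ->
  bracket X`_i X`_j = mu0 X i j + \sum_(k < (2 * p).+1)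
    \sum_(r < (2 * p).+1 | Delta (2 * p) k r) a k r *: Psi X k r i j.
Proof.
move=> ip jp; have [_ XE] := X_adapted.
by have := XE (inord i) (inord j); rewrite !inordK.
Qed.

Lemma bracket_adapted0 i j : (i <= 2 * p)%N -> (j <= 2 * p)%N ->
  (2 * p <= i + j)%N -> bracket X`_i X`_j = 0.
Proof.
move=> ip jp ij; rewrite bracket_adapted // /mu0 !ifN; [|lia|lia].
rewrite add0r big1 // => k _; rewrite big1 // => r /and3P[_ /andP[kr _] _].
have lt0 i' j' : (2 * p <= i' + j')%N -> Psi_lt X k r i' j' = 0.
  by move=> ij'; rewrite /Psi_lt ifN //; lia.
by rewrite /Psi (lt0 i j) // (lt0 j i) 1?addnC // oppr0 !if_same scaler0.
Qed.

Lemma bracket_adapted_first : (0 < p)%N ->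
  bracket X`_0 X`_(2 * p).-1 = X`_(2 * p).
Proof.
move=> p0; rewrite bracket_adapted; [|lia|lia].
rewrite /mu0 ifT; last lia.
rewrite prednK ?muln_gt0 // big1 ?addr0 // => k _; rewrite big1 // => r _.
rewrite /Psi ifT; last lia.
by rewrite /Psi_lt /= scaler0.
Qed.

(** Here [Psi k r] lands on index 2p + r - 2k - 2, so [r > 2 * k + 1] leaves only [r = 2 * k + 2],
    and [r <= 2 * p] forces [k < p]. Writing k = i + s turns the sum over [i <= k < p] into
    [A_coef]. *)
Lemma bracket_adapted_antidiag i j : (0 < i)%N -> (i < j)%N ->
  (i + j).+1 = (2 * p)%N ->
  bracket X`_i X`_j = A_coef p a (p - i) *: X`_(2 * p).
Proof.
move=> i0 ij ijp; rewrite bracket_adapted; [|lia|lia].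
rewrite /mu0 !ifN; [|lia|lia]; rewrite add0r.
pose F k : g := if (i <= k < p)%N then (a k (2 * k + 2) * ((-1) ^+ (k - i) *
  'C(j - k - 1, k - i)%:R)) *: X`_(2 * p) else 0.
transitivity (\sum_(0 <= k < (2 * p).+1) F k).
  rewrite big_mkord; apply: eq_bigr => k _.
  have [kp|kp] := boolP (i <= k < p)%N; last first.
    rewrite /F ifN // big1 // => r /and3P[_ /andP[kr rp] _].
    by rewrite /Psi ij /Psi_lt ifN ?scaler0 //; lia.
  have rP : (2 * k + 2 < (2 * p).+1)%N by lia.
  rewrite (bigD1 (Ordinal rP)) /=; last by rewrite /Delta /=; lia.
  rewrite big1 => [|r /andP[/and3P[_ /andP[kr rp] _]]]; last first.
    rewrite -val_eqE /= => rk.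
    by rewrite /Psi ij /Psi_lt ifN ?scaler0 //; lia.
  rewrite addr0 /F kp /Psi ij /Psi_lt ifT; last lia.
  by rewrite scalerA; congr (_ *: X`_ _); lia.
rewrite (big_cat_nat (n := i)) //=; last lia.
rewrite [X in _ + X](big_cat_nat (n := p)) /=; [|lia|lia].
rewrite big_nat big1 => [|k kP]; last by rewrite /F ifN //; lia.
rewrite [X in _ + (_ + X)]big_nat [X in _ + (_ + X)]big1 => [|k kP]; last first.
  by rewrite /F ifN //; lia.
rewrite add0r addr0 -{1}[i]add0n big_addn big_mkord /A_coef scaler_suml.
apply: eq_bigr => s _; rewrite /F ifT; last by have := ltn_ord s; lia.
have si := ltn_ord s.
rewrite addnK mulrCA mulrA; congr (_ * a _ _ * 'C(_, _)%:R *: _); lia.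
Qed.

Variable alpha : g -> R.
Hypothesis alpha_scalar : scalar alpha.

Let B x y := - alpha (bracket x y).

Let alphaZ c x := scalar_scale c x alpha_scalar.

Lemma ce_linearr x : scalar (B x).
Proof.
move=> c y z; rewrite /B bracket_linearr alpha_scalar; ring.
Qed.

Lemma ce_linearl y : scalar (B^~ y).
Proof.
move=> c x z; rewrite /B bracket_linearl alpha_scalar; ring.
Qed.

Lemma ce_alternating x : B x x = 0.
Proof. by rewrite /B bracketxx scalar0 ?oppr0. Qed.

Let ce_antisymmetric :=
  alternating_antisymmetric ce_linearr ce_alternating ce_linearl.

Lemma ce_adapted0 i j : (i <= 2 * p)%N -> (j <= 2 * p)%N ->
  (2 * p <= i + j)%N -> B X`_i X`_j = 0.
Proof.
by move=> *; rewrite /B bracket_adapted0 // scalar0 ?oppr0.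
Qed.

Lemma ce_basis0 x : (forall j, (j <= 2 * p)%N -> B x X`_j = 0) ->
  forall y, B x y = 0.
Proof.
have [Xb _] := X_adapted; move=> xX y; rewrite (coord_basis Xb (memvf y)).
rewrite (scalar_lin_comb _ _ (ce_linearr x)) big1 // => i _.
by rewrite xX ?mulr0 // -ltnS.
Qed.

Lemma dim_adapted : \dim (fullv : {vspace g}) = (p * 2).+1.
Proof. by have [Xb _] := X_adapted; rewrite (size_basis Xb) mulnC. Qed.

Lemma contact_form_of_A_coef : alpha X`_(2 * p) != 0 ->
  (forall j, (1 <= j <= p - 1)%N -> A_coef p a j != 0) ->
  contact_form p alpha.
Proof.
move=> an A0; split=> //.
have lt i j : (i < j)%N -> (i + j).+1 = p.*2 -> B X`_i X`_j != 0.
  rewrite -mul2n => ij ijp; rewrite /B oppr_eq0; case: (posnP i) => [i0|i0].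
    rewrite (_ : j = (2 * p).-1) ?i0 ?bracket_adapted_first //; lia.
  by rewrite bracket_adapted_antidiag // alphaZ mulf_neq0 // A0 //; lia.
have [||e [_ eJ]] :=
    antitriangular_symplectic ce_linearr ce_alternating ce_linearl (p := p)
      (v := nth 0 X).
- by move=> i j; rewrite -mul2n => ? ? ?; rewrite ce_adapted0 //; lia.
- move=> i j ij; case: (ltngtP i j) => h; first exact: lt.
  + by rewrite ce_antisymmetric oppr_eq0 lt // addnC.
  (* The case [i = j] is excluded by parity. *)
  + by move: ij; rewrite h; lia.
exists (fun i => oapp (e \o @nat_of_ord _) X`_(2 * p) (unlift ord0 i)).
apply: (contact_volume_symplectic ce_linearr ce_alternating ce_linearl) => //.
- by apply: ce_basis0 => j jp; rewrite ce_adapted0 //; lia.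
- by move=> i j; apply: eJ; rewrite -muln2.
Qed.

Lemma A_coef_of_contact_form : contact_form p alpha ->
  alpha X`_(2 * p) != 0 /\
  forall j, (1 <= j <= p - 1)%N -> A_coef p a j != 0.
Proof.
move=> [_ [v vol]]; have [Xb _] := X_adapted.
have nondeg x : alpha x = 0 -> (forall y, B x y = 0) -> x = 0.
  apply: (contact_volume_nondegenerate ce_linearr ce_alternating ce_linearl
    alpha_scalar dim_adapted vol).
have XnB y : B X`_(2 * p) y = 0.
  by apply: ce_basis0 => j jp; rewrite ce_adapted0 //; lia.
have /freeP Xfree := basis_free Xb.
have an : alpha X`_(2 * p) != 0.
  (* Otherwise [X_(2p)] is killed by both [alpha] and its differential, hence zero, against
     freeness. *)
  apply/eqP => an; have Xn0 := nondeg _ an XnB.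
  have := Xfree (fun i => (i == ord_max)%:R); rewrite (bigD1 ord_max) //=.
  rewrite eqxx scale1r Xn0 big1 ?addr0 => [/(_ erefl ord_max)/eqP|i /negPf->].
    by rewrite eqxx oner_eq0.
  by rewrite scale0r.
split=> // k kp; apply/eqP => Ak.
(* With its rows in reverse order, the Gram matrix of X_0, ..., X_(2p - 1) is
   triangular, and A_k is up to b_(2p) one of its diagonal entries. *)
pose M := \matrix_(i < 2 * p, j < 2 * p) B X`_j X`_(rev_ord i).
have detM : \det M = 0.
  rewrite det_trig; last first.
    apply/is_trig_mxP => i j ij; rewrite mxE ce_adapted0 //=; have := ltn_ord j;
      have := ltn_ord i; lia.
  (* Diagonal entry [p - k] pairs X_(p-k) with X_(p+k-1), whose bracket carries [A_coef p a k]. *)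
  have ip : (p - k < 2 * p)%N by lia.
  rewrite (bigD1 (Ordinal ip)) //= mxE /B bracket_adapted_antidiag /=;
    [|lia|lia|lia].
  by rewrite subKn ?Ak ?scale0r ?(scalar0 alpha_scalar) ?oppr0 ?mul0r //; lia.
have /det0P[c c0 cM] : \det M^T == 0 by rewrite det_tr detM.
pose x0 := \sum_(i < 2 * p) c 0 i *: X`_i.
(* [x0] is orthogonal to X_0, ..., X_(2p-1). This multiple of X_(2p), itself orthogonal to
   everything, corrects [x0] so that [alpha] vanishes too. *)
pose d := - (alpha x0 / alpha X`_(2 * p)).
have x_eq0 : d *: X`_(2 * p) + x0 = 0.
  apply: nondeg; first by rewrite alpha_scalar mulNr divfK // addNr.
  apply: ce_basis0 => j jp; rewrite ce_linearl XnB mulr0 add0r ce_antisymmetric.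
  rewrite (scalar_lin_comb _ _ (ce_linearr _)).
  have [jp'|jp'] := ltnP j (2 * p); last first.
    by rewrite big1 ?oppr0 // => i _; 
      rewrite ce_adapted0 ?mulr0 //; have := ltn_ord i; lia.
  have /matrixP/(_ 0 (rev_ord (Ordinal jp'))) := cM.
  rewrite !mxE => cM0; rewrite -sumrN -[RHS]cM0.
  apply: eq_bigr => i _; rewrite !mxE rev_ordK /= ce_antisymmetric; ring.
case/eqP: c0; apply/rowP => i; rewrite mxE.
have := Xfree (fun l => oapp (c 0) d (unlift ord_max l)).
rewrite big_ord_recr /= unlift_none /= addrC => Xf.
rewrite -(Xf _ (lift ord_max i)) ?liftK // -[RHS]x_eq0; congr (_ + _).
apply: eq_bigr => l _.
have -> : widen_ord (leqnSn (2 * p)) l = lift ord_max l.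
  by apply: val_inj; apply: esym; exact: lift_max.
by rewrite liftK.
Qed.

Lemma contact_formP : contact_form p alpha <->
  alpha X`_(2 * p) != 0 /\
  forall j, (1 <= j <= p - 1)%N -> A_coef p a j != 0.
Proof.
split; first exact: A_coef_of_contact_form.
by case; exact: contact_form_of_A_coef.
Qed.

End ContactFormsOnLieAlgebra.

(** * Calculus of functions of class C^k on an open set *)

Section Smoothness.
Local Open Scope classical_set_scope.
Variables (R : realType) (V : normedModType R).

(** Differentiability is local: the first-order expansion of [f] at [x], remainder included, is also
    one of [g]. *)
Lemma near_eq_differentiable (W : normedModType R) (f g : V -> W) x :
  (\near x, f x = g x) -> differentiable f x -> differentiable g x.
Proof.
move=> fg df.
have dgE : g \o shift x = cst (g x) + 'd f x +o_ 0 id.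
  have := diff_locally df; rewrite -(nbhs_singleton fg) => /eqaddoP dfE.
  apply/eqaddoP => e e0; have := dfE e e0; apply: filter_app.
  have : \forall h \near 0, f (h + x) = g (h + x).
    by move: fg; rewrite (near_shift 0) subr0.
  by apply: filter_app; near=> h => fgh; rewrite !fctE /= fgh.
have dc := diff_continuous df.
by apply/diff_locallyP; rewrite (diff_unique dc dgE).
Unshelve. all: by end_near. Qed.

(** The rules of differentiation hold only at points of [U], so the inductions below replace each
    derivative by a formula that agrees with it on [U]. *)
Lemma Ck_eq (W : normedModType R) k (U : set V) (f g : V -> W) :
  open U -> (forall x, U x -> f x = g x) -> Ck k U f -> Ck k U g.
Proof.
move=> Uo; elim: k f g => [|k IH] f g fg.
  move=> fc x Ux; change (g y @[y --> x] --> g x); rewrite -(fg x Ux).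
  apply: cvg_trans (fc x Ux); apply: near_eq_cvg.
  by apply: filterS (open_nbhs_nbhs (conj Uo Ux)) => y /fg.
have nfg x : U x -> \near x, f x = g x.
  by move=> Ux; apply: filterS (open_nbhs_nbhs (conj Uo Ux)) => y /fg.
move=> [fd fk]; split=> [x Ux|v].
  exact: near_eq_differentiable (nfg x Ux) (fd x Ux).
by apply: IH (fk v) => x Ux; exact/near_eq_derive/nfg.
Qed.

Lemma CkW (W : normedModType R) k (U : set V) (f : V -> W) :
  Ck k.+1 U f -> Ck k U f.
Proof.
elim: k f => [|k IH] f [fd fk].
  by move=> x Ux; exact/differentiable_continuous/fd.
by split=> // v; apply: IH.
Qed.

Lemma Ck_cst (W : normedModType R) k (U : set V) (c : W) : Ck k U (fun=> c).
Proof.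
elim: k c => [|k IH] c; first by move=> x _; exact: cst_continuous.
split=> [x _|v]; first exact: differentiable_cst.
by have -> : 'D_v (fun=> c) = (fun=> 0) by apply/funext => x; exact: derive_cst.
Qed.

Variable U : set V.
Hypothesis U_open : open U.

Lemma CkD (W : normedModType R) k (f g : V -> W) :
  Ck k U f -> Ck k U g -> Ck k U (fun x => f x + g x).
Proof.
elim: k f g => [|k IH] f g.
  by move=> fc gc x Ux; apply: continuousD; auto.
move=> [fd fk] [gd gk]; split=> [x Ux|v].
  by apply: differentiableD; auto.
apply: Ck_eq (IH _ _ (fk v) (gk v)) => // x Ux.
by apply/esym/deriveD; apply: diff_derivable; auto.
Qed.

Lemma CkM k (f g : V -> R) :
  Ck k U f -> Ck k U g -> Ck k U (fun x => f x * g x).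
Proof.
elim: k f g => [|k IH] f g.
  by move=> fc gc x Ux; apply: continuousM; auto.
(* The Leibniz formula contains [f] and [g] themselves besides their derivatives, so they are needed
   at order [k]. *)
move=> fk1 gk1; have fk := CkW fk1; have gk := CkW gk1.
case: fk1 gk1 => [fd fk1] [gd gk1]; split=> [x Ux|v].
  by apply: differentiableM; auto.
apply: Ck_eq (CkD (IH _ _ fk (gk1 v)) (IH _ _ gk (fk1 v))) => // x Ux.
by apply/esym/deriveM; apply: diff_derivable; auto.
Qed.

Lemma CkV k (f : V -> R) : (forall x, U x -> f x != 0) ->
  Ck k U f -> Ck k U (fun x => (f x)^-1).
Proof.
move=> f0; elim: k => [|k IH].
  by move=> fc x Ux; apply: continuousV; auto.
move=> fk1; have Vk := IH (CkW fk1); case: fk1 => fd fk1; split=> [x Ux|v].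
  by apply: differentiableV; auto.
(* This is the factor - 1 / f^2 of the derivative of 1 / f; 1 / f is of class C^k by induction. *)
have Nk := CkM (Ck_cst k U (-1 : R)) (CkM Vk Vk).
apply: Ck_eq (CkM Nk (fk1 v)) => // x Ux.
rewrite deriveV; [|exact: f0|by apply: diff_derivable; auto].
by rewrite -invfM -expr2 mulN1r.
Qed.

Lemma smooth_cst (W : normedModType R) (c : W) : smooth U (fun=> c).
Proof. by move=> k; exact: Ck_cst. Qed.

Lemma smoothM (f g : V -> R) :
  smooth U f -> smooth U g -> smooth U (fun x => f x * g x).
Proof. by move=> fs gs k; exact: CkM. Qed.

Lemma smoothV (f : V -> R) : (forall x, U x -> f x != 0) ->
  smooth U f -> smooth U (fun x => (f x)^-1).
Proof. by move=> f0 fs k; exact: CkV. Qed.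

Lemma smooth_sum (I : finType) (P : pred I) (f : I -> V -> R) :
  (forall i, smooth U (f i)) -> smooth U (fun x => \sum_(i | P i) f i x).
Proof.
move=> fs k; rewrite unlock; elim: (index_enum I) => /= [|i r IH].
  exact: Ck_cst.
by case: (P i) => //; apply: CkD => //; exact: fs.
Qed.

Lemma smooth_prod (I : finType) (P : pred I) (f : I -> V -> R) :
  (forall i, smooth U (f i)) -> smooth U (fun x => \prod_(i | P i) f i x).
Proof.
move=> fs k; rewrite unlock; elim: (index_enum I) => /= [|i r IH].
  exact: Ck_cst.
by case: (P i) => //; apply: CkM => //; exact: fs.
Qed.

Lemma smooth_det n (M : V -> 'M[R]_n) :
  (forall i j, smooth U (fun x => M x i j)) -> smooth U (fun x => \det (M x)).
Proof.
move=> Ms; rewrite /determinant; apply: smooth_sum => s; apply: smoothM.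
  exact: smooth_cst.
exact: smooth_prod.
Qed.

Lemma smooth_coord m n (f : V -> 'M[R]_(m, n)) i j :
  smooth U f -> smooth U (fun x => f x i j).
Proof.
move=> fs k; elim: k f fs => [|k IH] f fs.
  move=> x Ux.
  apply: (@continuous_comp _ _ _ f (fun N : 'M[R]_(_, _) => N i j)).
    exact: (fs 0%N).
  exact: coord_continuous.
have [fd _] := fs 1%N; split=> [x Ux|v].
  exact: (differentiable_comp (fd x Ux) (differentiable_coord (f x) i j)).
apply: (@Ck_eq _ _ _ (fun x => 'D_v f x i j)) => //.
  by move=> x Ux; rewrite derive_mx ?mxE //; apply: diff_derivable; auto.
by apply: IH => l; have [_ fl] := fs l.+1; exact: fl.
Qed.

End Smoothness.

(** * Left invariant forms on the group and linear forms on its Lie algebra *)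

Section LeftInvariantForms.
Local Open Scope classical_set_scope.
Variables (R : realType) (m : nat) (G : lieGroup R m) (g : lieAlgebra R).
Variables (iota : g -> local_field G) (g_lie : is_lie_algebra_of iota).
Variables (X : m.-tuple g) (X_basis : basis_of fullv X).

(** Left translations act transitively, so left invariant objects are determined by their values at
    one point. *)
Lemma translation (i j : atlas G) z z' : img i z -> img j z' ->
  exists h, Defs.dom j (h * param i z)%g /\ ltrans h i j z = z'.
Proof.
move=> _ [y' yj <-]; exists (y' * (param i z)^-1)%g.
by rewrite /ltrans mulgKV.
Qed.

Lemma iota_lin_comb n (c : 'I_n -> R) (x : 'I_n -> g) (i : atlas G) z :
  img i z -> iota (\sum_k c k *: x k) i z = \sum_k c k *: iota (x k) i z.
Proof.
move=> iz; apply: (linear_lin_comb (f := fun x => iota x i z)) => d y y'.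
exact: (iota_linear g_lie).
Qed.

Lemma iota_eq0 (i : atlas G) z x : img i z -> iota x i z = 0 -> x = 0.
Proof.
move=> iz xz; apply: (iota_injective g_lie) => j z' jz'.
have [h [hj <-]] := translation iz jz'.
have [_ ->] // := iota_left_invariant g_lie x.
by rewrite xz linear0.
Qed.

Definition frame_mx (i : atlas G) z : 'M[R]_m :=
  \matrix_(k, l) iota X`_k i z 0 l.

Lemma mul_frame_mx (i : atlas G) z (u : 'rV[R]_m) : img i z ->
  u *m frame_mx i z = iota (\sum_(k < m) u 0 k *: X`_k) i z.
Proof.
move=> iz; rewrite iota_lin_comb //; apply/rowP => l.
rewrite mxE summxE; apply: eq_bigr => k _.
by rewrite !mxE.
Qed.

(** A vector in the left kernel yields a combination of the basis whose field vanishes at [z]; by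
    [iota_eq0] it is zero, and freeness applies. *)
Lemma frame_mx_unit (i : atlas G) z : img i z -> frame_mx i z \in unitmx.
Proof.
move=> iz; rewrite unitmxE unitfE; apply/det0P => -[u u0].
rewrite mul_frame_mx // => /(iota_eq0 iz) uX0; case/eqP: u0.
have /freeP Xfree := basis_free X_basis.
by apply/rowP => k; rewrite mxE (Xfree (fun k => u 0 k)).
Qed.

Lemma iota_onto (i : atlas G) z v : img i z -> exists x, iota x i z = v.
Proof.
move=> iz; exists (\sum_(k < m) (v *m invmx (frame_mx i z)) 0 k *: X`_k).
by rewrite -mul_frame_mx // mulmxKV // frame_mx_unit.
Qed.

Section OneForm.
Variables (w : local_form G) (w_inv : left_invariant_form w).

Definition algebra_form (i : atlas G) z : g -> R :=
  fun x => w i z (iota x i z).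

Lemma left_invariant_pairing (i j : atlas G) z z' x : img i z -> img j z' ->
  w j z' (iota x j z') = w i z (iota x i z).
Proof.
move=> iz jz'; have [h [hj <-]] := translation iz jz'.
have [_ ->] // := iota_left_invariant g_lie x.
by have [_ _ ->] := w_inv.
Qed.

(* The pairing w (iota x) is constant, so differentiating w moves to iota x. *)
Lemma derive_form_field (i : atlas G) z x v : img i z ->
  'D_v (fun z' => w i z' (iota x i z)) z = - w i z ('D_v (iota x i) z).
Proof.
move=> iz; have [wl ws _] := w_inv; have [xs _] := iota_left_invariant g_lie x.
have nimg : \forall z' \near z, img i z'.
  by apply: open_nbhs_nbhs; split=> //; exact: img_open.
pose e k : 'rV[R]_m := delta_mx 0 k.
have wE z' u : img i z' -> w i z' u = \sum_(k < m) u 0 k * w i z' (e k).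
  move=> iz'; rewrite {1}[u]row_sum_delta.
  exact: (scalar_lin_comb _ _ (wl i z' iz')).
have dw u : derivable (fun z' => w i z' u) z v.
  by apply: diff_derivable; have [+ _] := ws i u 1%N; apply.
have dx : derivable (iota x i) z v.
  by apply: diff_derivable; have [+ _] := xs i 1%N; apply.
have /derivable_mxP dxk := dx.
(* [D1] freezes the field at [z], while [D2] differentiates it as well. [D3] says that the total
   derivative is zero, so the two parts are opposite. *)
have D1 : 'D_v (fun z' => w i z' (iota x i z)) z =
    \sum_(k < m) iota x i z 0 k * 'D_v (fun z' => w i z' (e k)) z.
  rewrite (@near_eq_derive _ _ _ _
    (\sum_(k < m) (fun z' => iota x i z 0 k * w i z' (e k)))); last first.
    by apply: filterS nimg => z' iz'; rewrite fct_sumE wE.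
  rewrite derive_sum => [|k]; last exact: derivableM.
  by apply: eq_bigr => k _; rewrite deriveMl.
have D2 : 'D_v (fun z' => w i z' (iota x i z')) z =
    \sum_(k < m) (iota x i z 0 k * 'D_v (fun z' => w i z' (e k)) z +
      w i z (e k) * 'D_v (fun z' => iota x i z' 0 k) z).
  rewrite (@near_eq_derive _ _ _ _
    (\sum_(k < m) (fun z' => iota x i z' 0 k * w i z' (e k)))); last first.
    by apply: filterS nimg => z' iz'; rewrite fct_sumE wE.
  rewrite derive_sum => [|k]; last exact: derivableM.
  by apply: eq_bigr => k _; rewrite deriveM.
have D3 : 'D_v (fun z' => w i z' (iota x i z')) z = 0.
  rewrite (@near_eq_derive _ _ _ _ (cst (w i z (iota x i z)))).
    exact: derive_cst.
  by apply: filterS nimg => z' iz'; exact: left_invariant_pairing.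
rewrite D1 wE // derive_mx //; apply/eqP; rewrite -addr_eq0 -[eqbRHS]D3 D2.
rewrite big_split /=; apply/eqP; congr (_ + _); apply: eq_bigr => k _.
by rewrite mxE mulrC.
Qed.

(** [derive_form_field] turns both terms of [ext_diff] into derivatives of the fields, whose
    difference is the field bracket. *)
Lemma ext_diff_left_invariant (i : atlas G) z x y : img i z ->
  ext_diff w i z (fun k : 'I_2 => iota (if k == ord0 then x else y) i z) =
  - w i z (iota (bracket x y) i z).
Proof.
move=> iz; have [wl _ _] := w_inv; rewrite /ext_diff /=.
rewrite !derive_form_field // (iota_bracket g_lie) // /field_bracket.
rewrite [X in _ = - w i z X]addrC
  -[X in _ = - w i z (X + _)]scaleN1r (wl i z iz); ring.
Qed.

Lemma contact_volume_left_invariant p (i : atlas G) z v : img i z ->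
  contact_volume p (w i z) (ext_diff w i z) (fun k => iota (v k) i z) =
  contact_volume p (algebra_form i z) (ce_diff (algebra_form i z)) v.
Proof.
move=> iz; apply: (contact_volume_pullback (f := fun x => iota x i z)) => // u.
rewrite /ce_diff /algebra_form -ext_diff_left_invariant //.
Qed.

Lemma algebra_form_scalar (i : atlas G) z :
  img i z -> scalar (algebra_form i z).
Proof.
move=> iz c x y; have [wl _ _] := w_inv.
by rewrite /algebra_form (iota_linear g_lie) // wl.
Qed.

End OneForm.

(** Multiplying by the inverse frame gives the coordinates of [v] in the basis fields at [z];
    [alpha] is applied to the element of [g] with these coordinates. *)
Definition extend_form (alpha : g -> R) : local_form G :=
  fun i z v => (v *m invmx (frame_mx i z) *m \col_k alpha X`_k) 0 0.

Lemma extend_formE alpha (i : atlas G) z x : scalar alpha -> img i z ->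
  extend_form alpha i z (iota x i z) = alpha x.
Proof.
move=> la iz; rewrite /extend_form (coord_basis X_basis (memvf x)).
rewrite (_ : iota _ _ _ = (\row_k coord X k x) *m frame_mx i z); last first.
  by rewrite mul_frame_mx //; congr iota; apply: eq_bigr => k _; rewrite mxE.
rewrite mulmxK ?frame_mx_unit // mxE (scalar_lin_comb _ _ la).
by apply: eq_bigr => k _; rewrite !mxE.
Qed.

Lemma extend_form_left_invariant alpha :
  scalar alpha -> left_invariant_form (extend_form alpha).
Proof.
move=> la; split.
- move=> i z iz c x y; rewrite /extend_form !mulmxDl -!scalemxAl mxE.
  by rewrite mxE.
- move=> i v; have iO : open (img i) by exact: img_open.
  have frame_smooth k l : smooth (img i) (fun z => frame_mx i z k l).
    have [+ _] := iota_left_invariant g_lie X`_k.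
    move=> /(_ i)/(smooth_coord iO 0 l).
    by congr smooth; apply/funext => z; rewrite mxE.
  have det_smooth : smooth (img i) (fun z => \det (frame_mx i z)).
    exact: smooth_det.
  have adj_smooth k l : smooth (img i) (fun z => (\adj (frame_mx i z)) k l).
    rewrite (_ : (fun _ => _) = (fun z => (-1) ^+ (l + k) *
      \det (row' l (col' k (frame_mx i z))))); last first.
      by apply/funext => z; rewrite mxE.
    apply: smoothM => //; first exact: smooth_cst.
    apply: smooth_det => // k' l'.
    rewrite (_ : (fun _ => _) =
      (fun z => frame_mx i z (lift l k') (lift k l'))) //.
    by apply/funext => z; rewrite !mxE.
  (* Cramer's rule: the adjugate and the determinant are polynomial in the smooth frame entries. *)
  move=> n; apply: (Ck_eq (f := fun z => (\det (frame_mx i z))^-1 *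
    \sum_(k < m) \sum_(l < m) v 0 l * (\adj (frame_mx i z)) l k * alpha X`_k)).
  + by [].
  + move=> z iz; rewrite /extend_form /invmx frame_mx_unit //.
    rewrite -scalemxAr -scalemxAl mxE; congr (_ * _); rewrite mxE.
    apply: eq_bigr => k _; rewrite !mxE mulr_suml.
    by apply: eq_bigr => l _.
  + apply: smoothM => //.
    * apply: smoothV => //.
      by move=> z iz; rewrite -unitfE -unitmxE frame_mx_unit.
    * apply: smooth_sum => // k.
      apply: smooth_sum => // l.
      apply: smoothM; [by []| |exact: smooth_cst].
      by apply: smoothM => //; exact: smooth_cst.
(* Every tangent vector is the value of some [iota x], and both sides then equal [alpha x]. *)
- move=> h i j z iz hj v; have [x <-] := iota_onto v iz.
  have [_ <-] // := iota_left_invariant g_lie x.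
  rewrite !extend_formE //; exists (h * param i z)%g => //.
Qed.

(** A form on the group is restricted to [g] by evaluation at one point, and [alpha] is extended by
    [extend_form]; the same elements of [g] then witness nonvanishing at every point. *)
Lemma left_invariant_contact_formP p : (exists i : atlas G, exists z, img i z) ->
  (exists w : local_form G, left_invariant_contact_form p w) <->
  (exists alpha : g -> R, contact_form p alpha).
Proof.
move=> [i0 [z0 iz0]]; split=> [[w [w_inv w_contact]]|[alpha [la [v vol]]]].
  exists (algebra_form w i0 z0); split; first exact: algebra_form_scalar.
  have [u vol] := w_contact _ _ iz0.
  have [v vE] := boolp.choice (fun k => iota_onto (u k) iz0).
  exists v; rewrite -contact_volume_left_invariant //.
  by rewrite (_ : (fun k => _) = u) //; apply/funext.
exists (extend_form alpha); split; first exact: extend_form_left_invariant.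
move=> i z iz; exists (fun k => iota (v k) i z).
rewrite contact_volume_left_invariant //; last exact: extend_form_left_invariant.
rewrite (_ : algebra_form _ _ _ = alpha) //.
by apply/funext => x; rewrite /algebra_form extend_formE.
Qed.

End LeftInvariantForms.

Theorem theorem2p7 (R : realType) (p : nat) (G : lieGroup R (2 * p).+1)
    (g : lieAlgebra R) (iota : g -> local_field G)
    (g_lie : is_lie_algebra_of iota) (g_filiform : filiform g)
    (X : (2 * p).+1.-tuple g) (a : nat -> nat -> R)
    (X_adapted : adapted_basis X a) :
  ((exists w : local_form G, left_invariant_contact_form p w) <->
   (forall j : nat, (1 <= j <= p - 1)%N -> A_coef p a j != 0)) /\
  ((forall j : nat, (1 <= j <= p - 1)%N -> A_coef p a j != 0) ->
   forall b : 'I_(2 * p).+1 -> R,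
     contact_form p (fun x : g => \sum_(i < (2 * p).+1) b i * coord X i x) <->
     b ord_max != 0).
Proof.
have [Xb _] := X_adapted.
have coords_scalar (b : 'I_(2 * p).+1 -> R) :
    scalar (fun x : g => \sum_(i < (2 * p).+1) b i * coord X i x).
  move=> c x y; rewrite mulr_sumr -big_split; apply: eq_bigr => i _ /=.
  by rewrite linearP /= mulrDr mulrCA.
(* [b_(2p)] is the value at X_(2p), the number tested by [contact_formP]. *)
have coords_last (b : 'I_(2 * p).+1 -> R) :
    \sum_(i < (2 * p).+1) b i * coord X i X`_(2 * p) = b ord_max.
  rewrite (bigD1 ord_max) //= big1 => [|i /negPf im].
    by rewrite (coord_free ord_max ord_max (basis_free Xb)) eqxx mulr1 addr0.
  by rewrite (coord_free ord_max i (basis_free Xb)) eq_sym im mulr0.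
split=> [|A0 b]; last first.
  by rewrite (contact_formP X_adapted (coords_scalar b)) coords_last; tauto.
have [i i1] := dom_cover (1%g : G).
rewrite (left_invariant_contact_formP g_lie Xb p); last first.
  by exists i, (chart i 1%g), 1%g.
split=> [[alpha alphaC]|A0].
  have [la _] := alphaC; exact: ((contact_formP X_adapted la).1 alphaC).2.
(* The witness is the last dual basis form, with [b_(2p) = 1]. *)
exists (fun x : g => \sum_(i < (2 * p).+1) (i == ord_max)%:R * coord X i x).
apply/(contact_formP X_adapted (coords_scalar _)).
by rewrite coords_last eqxx oner_eq0.
Qed.
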